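(* Let $(S,M)$ be a marked surface (as in the context) which is not a disc, with boundary components $B_1,\ldots,B_b$. Let $\Delta$ be an ideal triangulation of $(S,M)$, $d$ an admissible cut on $Q^\Delta$, and $\Lambda$ the surface algebra associated with $(\Delta,d)$. For $i=1,\ldots,b$ let $c_i$ be a simple closed curve surrounding $B_i$ and following the orientation of $S$, and let $(n_i,m_i)$ be the ordered pair of the AG-invariant of $\Lambda$ corresponding to $B_i$. Then for every $i=1,\ldots,b$, \[ n_i=p_i+d(\bar c_i)\quad\text{and}\quad m_i=p_i+2d(\bar c_i),\] where $p_i$ is the number of marked points on $B_i$.
   Context: Marked surface. $S$ is a connected compact oriented surface of genus $g$ with non-empty boundary $\partial S=B_1\sqcup\cdots\sqcup B_b$ (each $B_i$ a circle); $M\subset\partial S$ is finite with $p_i=\sharp(M\cap B_i)\ge 1$ for all $i$. An arc is a simple curve in $S$ (no self-intersection, except that its endpoints may coincide) with endpoints in $M$ which does not cut out a monogon or a digon, up to isotopy. Two arcs are compatible if they have representatives that do not intersect (except possibly at endpoints). An ideal triangulation $\Delta$ is a maximal collection of pairwise compatible arcs; it cuts $S$ into triangles whose sides are arcs or boundary segments. A triangle is internal if its three sides are arcs. Quiver. $Q=Q^\Delta$ has $Q_0$ = arcs of $\Delta$, and $Q_1$ = angles: for each triangle and each corner of it between two sides that are arcs, one arrow $\alpha:s(\alpha)\to t(\alpha)$ between these arcs, directed by the orientation of $S$ (say, $t(\alpha)$ follows $s(\alpha)$ clockwise around the corner). $Q_2$ is the set of oriented 3-cycles given by internal triangles. With this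 convention, ''$c_i$ follows the orientation of $S$'' means that $c_i$ is parallel to $B_i$ with $B_i$ on its right, so that when passing by a marked point of $B_i$ it follows the angles at this point in the direction of the arrows (the opposite convention, used for both simultaneously, is equivalent). The element $\bar\gamma$. An oriented simple closed curve $\gamma$ can be isotoped to intersect arcs of $\Delta$ transversally and never the same arc twice in succession; then in each triangle it consists of segments each parallel to an angle. For $\alpha\in Q_1$ in the triangle $\tau$, let $(\gamma\cap\alpha)^{+}$ (resp. $(\gamma\cap\alpha)^-$) be the set of segments of $\gamma\cap\tau$ parallel to $\alpha$ and going from $s(\alpha)$ to $t(\alpha)$ (resp. from $t(\alpha)$ to $s(\alpha)$). Put $\bar\gamma=\sum_{\alpha\in Q_1}(|(\gamma\cap\alpha)^+|-|(\gamma\cap\alpha)^-|)\alpha\in\mathbb{Z}Q_1$. Maps $d:Q_1\to\mathbb{Z}$ are extended linearly to $\mathbb{Z}Q_1$. Surface algebra. An admissible cut is a map $d:Q_1\to\{0,1\}$ with $d(a)+d(b)+d(c)=1$ for every $abc\in Q_2$ and $d(\alpha)=1$ only if $\alpha$ belongs to some $\tau\in Q_2$. The surface algebra $\Lambda$ of $(\Delta,d)$ is the degree zero part, for the grading induced by $d$, of the Jacobian algebra $\mathrm{Jac}(Q^\Delta,W^\Delta)$ with $W^\Delta=\sum_{\tau\in Q_2}\tau$ (over an algebraically closed field $k$; concretely $\mathrm{Jac}(Q^\Delta,W^\Delta)$ is $kQ$ modulo the paths of length 2 contained in 3-cycles of $Q_2$). It is a gentle algebra. AG-invariant. The Avella-Alaminos–Geiss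 invariant of a gentle algebra is a function $AG(\Lambda):\mathbb{N}^2\to\mathbb{N}$, i.e. a finite multiset of ordered pairs $(n,m)$. By a theorem of David-Roesler and Schiffler, for the surface algebra $\Lambda$ of $(\Delta,d)$, where $\Delta$ is an ideal triangulation of the marked surface $(S,M)$ and $d$ is an admissible cut on $Q^\Delta$, these pairs are in bijection with the boundary components of $S$, the pair corresponding to $B_i$ being $n_i=n(B_i,\Delta)+\ell_i$, $m_i=m(B_i,\Delta)+2\ell_i$, where $n(B_i,\Delta)$ is the number of marked points on $B_i$ incident to at least one arc of $\Delta$, $m(B_i,\Delta)$ is the number of boundary segments on $B_i$ both of whose marked endpoints are incident with at least one arc of $\Delta$, and $\ell_i$ is the number of local cuts on $B_i$, i.e. the number of arrows $\alpha$ with $d(\alpha)=1$ whose angle has its vertex at a marked point of $B_i$. *)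

(* Defs.v *)
From mathcomp Require Import all_boot all_order all_algebra.
From Stdlib Require Import Relation_Operators.

Set Implicit Arguments.
Unset Strict Implicit.
Unset Printing Implicit Defensive.

Import GRing.Theory.

(******************************************************************************)
(* An ideal triangulation of a marked surface (S, M) is presented by the way  *)
(* its triangles are glued. A side is a side of one of the triangles,         *)
(* directed so that its triangle lies on its left; [nxt] goes to the next     *)
(* side of the triangle, counterclockwise for the orientation of S. An arc    *)
(* has two sides, exchanged by [glue] (which reverses directions, so S is     *)
(* oriented); a side fixed by [glue] is a boundary segment, directed as the   *)
(* boundary of S.                                                             *)
(******************************************************************************)

Record gluing := Gluing {
  side : finType;
  nxt : side -> side;
  glue : side -> side;
  nxt_cycle3 : forall x, nxt (nxt (nxt x)) = x;
  nxt_neq : forall x, nxt x != x;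
  glue_involutive : involutive glue
}.

Section Gluing.

Variable G : gluing.
Implicit Types (x y : side G) (c : seq (side G)).

Definition triangle x : {set side G} := [set x; nxt x; nxt (nxt x)].

Definition on_bdry x := glue x == x.
Definition on_arc x := ~~ on_bdry x.

(* When x is a side of an arc, x and [turn x] start at the same marked point, *)
(* and [turn x] immediately follows x clockwise around it. When x is a        *)
(* boundary segment, [turn x] starts where x ends.                            *)
Definition turn x := nxt (glue x).

Definition about : rel (side G) := [rel x y | on_arc x && (y == turn x)].

(* The point at which x starts, as the set of all the sides starting there.   *)
Definition start x : {set side G} :=
  [set y | connect [rel y z | about y z || about z y] x y].

Definition end_ x : {set side G} := start (nxt x).

End Gluing.

(* [all_marked]: every vertex lies on the boundary of S, so that the set of   *)
(* the vertices is a set M of marked points on the boundary. There being no   *)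
(* interior vertex, an Euler characteristic count shows that no arc cuts out  *)
(* a monogon or a digon and that no two arcs are isotopic.                    *)
Record surface := Surface {
  gluing_of :> gluing;
  side_ex : 0 < #|side gluing_of|;
  glue_connected : forall x y : side gluing_of,
    connect [rel y z | (z == nxt y) || (z == glue y)] x y;
  all_marked : forall x : side gluing_of,
    exists2 y, y \in start x & on_bdry y
}.

Section Surface.

Variable S : surface.
Implicit Types (x y : side S) (c : seq (side S)).

Definition marked_points : {set {set side S}} := [set start x | x : side S].

Definition bdry_segments : {set side S} := [set x | on_bdry x].

Definition bdry_succ : rel (side S) :=
  [rel x y | [&& on_bdry x, on_bdry y & end_ x == start y]].

Definition bdry_components : {set {set side S}} :=
  [set [set y | connect bdry_succ x y] | x in bdry_segments].

Definition component := {B : {set side S} | B \in bdry_components}.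

Definition triangles : {set {set side S}} := [set triangle x | x : side S].

Definition arc_of x : {set side S} := [set x; glue x].

Definition arcs : {set {set side S}} := [set arc_of x | x in @on_arc S].

Definition arc := {e : {set side S} | e \in arcs}.

Definition euler_characteristic : int :=
  (#|marked_points|%:Z - (#|arcs| + #|bdry_segments|)%:Z + #|triangles|%:Z)%R.

(* The Euler characteristic of a surface of genus g with b boundary           *)
(* components is 2 - 2 * g - b, and a disc is the case g = 0, b = 1.          *)
Definition is_disc : bool :=
  (#|bdry_components| == 1) && (euler_characteristic == 1%R).

(* The arrow x is the angle between x and nxt x, whose vertex is the end of   *)
(* x; the side nxt x follows x clockwise about it.                            *)
Definition arrow := {x : side S | on_arc x && on_arc (nxt x)}.

Lemma arc_of_arc x : on_arc x -> arc_of x \in arcs.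
Proof. by move=> arc_x; apply: imset_f. Qed.

Definition arrow_src (a : arrow) : arc :=
  exist _ (arc_of (val a)) (arc_of_arc (proj1 (andP (valP a)))).
Definition arrow_tgt (a : arrow) : arc :=
  exist _ (arc_of (nxt (val a))) (arc_of_arc (proj2 (andP (valP a)))).

Definition follows_in_triangle : rel arrow :=
  [rel a b | val b == nxt (val a)].

(* abc is one of the oriented 3-cycles of Q_2. *)
Definition three_cycle (a b c : arrow) : bool :=
  follows_in_triangle a b && follows_in_triangle b c.

Definition admissible_cut (d : arrow -> int) : Prop :=
  [/\ forall a, d a = 0%R \/ d a = 1%R,
      forall a b (c : arrow), three_cycle a b c -> (d a + d b + d c)%R = 1%R
    & forall a, d a = 1%R -> exists b (c : arrow), three_cycle a b c].

(******************************************************************************)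
(* Closed curves, recorded up to isotopy by the cyclic sequence of the arcs   *)
(* they cross: x stands for a crossing which leaves the triangle of x through *)
(* x, and enters the triangle of glue x.                                      *)
(******************************************************************************)

Definition crosses_next : rel (side S) :=
  [rel x y | [&& on_arc x, on_arc y & y \in triangle (glue x)]].

Definition closed_curve c : bool := cycle crosses_next c.

Definition no_repeated_arc c : bool :=
  cycle [rel x y | arc_of x != arc_of y] c.

Inductive elementary_homotopy : seq (side S) -> seq (side S) -> Prop :=
| HomotopyBasepoint n c :
    closed_curve c -> elementary_homotopy c (rot n c)
| HomotopyBacktrack x c :
    closed_curve [:: x, glue x & c] ->
    elementary_homotopy [:: x, glue x & c] c.

(* Free homotopy of oriented closed curves; as S retracts onto the graph dual *)
(* to the triangulation, it is generated by the removal of backtracks.        *)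
Definition homotopic : seq (side S) -> seq (side S) -> Prop :=
  clos_refl_sym_trans _ elementary_homotopy.

(* The curve parallel to the boundary component of the boundary segment x,    *)
(* following the boundary closely on its right: it crosses, in order, the end *)
(* of each arc at each marked point, and is parallel to the boundary segment  *)
(* at each term of the orbit which is not on an arc.                          *)
Definition collar_curve x : seq (side S) := [seq y <- orbit (@turn S) x | on_arc y].

(* c surrounds B, follows the orientation of S, and is put in the position in *)
(* which its class in Z Q_1 is defined. Isotopic and freely homotopic are the *)
(* same for simple closed curves, and collar curves are simple.               *)
Definition surrounds (B : component) c : Prop :=
  [/\ closed_curve c, no_repeated_arc c
    & exists2 x, x \in val B & homotopic (collar_curve x) c].

(* A pair (x, y) of successive crossings is a segment in the triangle of      *)
(* glue x, which it enters through glue x and leaves through y.               *)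
Definition segments c : seq (side S * side S) := zip c (rot 1 c).

Definition pos_segments (a : arrow) c : nat :=
  count (fun s => (glue s.1 == val a) && (s.2 == nxt (val a))) (segments c).
Definition neg_segments (a : arrow) c : nat :=
  count (fun s => (glue s.1 == nxt (val a)) && (s.2 == val a)) (segments c).

Definition curve_class c : {ffun arrow -> int} :=
  [ffun a => ((pos_segments a c)%:Z - (neg_segments a c)%:Z)%R].

Definition linear_extension (d : arrow -> int) (u : {ffun arrow -> int}) : int :=
  (\sum_a u a * d a)%R.

Definition points_on (B : component) : {set {set side S}} :=
  [set start x | x in val B].

(* Of the two sides of an arc, one starts at each end of the arc. *)
Definition incident_to_arc (v : {set side S}) : bool :=
  [exists y in v, on_arc y].

Definition incident_points (B : component) : nat :=
  #|[set v in points_on B | incident_to_arc v]|.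

Definition incident_segments (B : component) : nat :=
  #|[set x in val B | incident_to_arc (start x) && incident_to_arc (end_ x)]|.

Definition local_cuts (d : arrow -> int) (B : component) : nat :=
  #|[set a : arrow | (d a == 1%R) && (end_ (val a) \in points_on B)]|.

End Surface.

(******************************************************************************)
(* The Avella-Alaminos--Geiss invariant of a gentle algebra, given by a       *)
(* connected quiver with at least one arrow and relations of length 2;        *)
(* [zero a b] means that a followed by b is a relation.                       *)
(******************************************************************************)

Record bound_quiver := BoundQuiver {
  vertex : finType;
  edge : finType;
  src : edge -> vertex;
  tgt : edge -> vertex;
  zero : rel edge
}.

Section AG.

Variable Q : bound_quiver.
Implicit Types (v : vertex Q) (a b c : edge Q).

Definition permitted_step : rel (edge Q) :=
  [rel a b | (tgt a == src b) && ~~ zero a b].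
Definition forbidden_step : rel (edge Q) :=
  [rel a b | (tgt a == src b) && zero a b].

(* A starting vertex and a list of arrows without repetition. *)
Definition qpath := (vertex Q * #|edge Q|.-bseq (edge Q))%type.

Definition path_start (h : qpath) : vertex Q := h.1.
Definition path_end (h : qpath) : vertex Q := last h.1 (map (@tgt Q) h.2).

(* The trivial threads, and the maximal paths for r. For permitted threads    *)
(* [uniq] is no restriction: in a finite dimensional gentle algebra a nonzero *)
(* path repeats no arrow.                                                     *)
Definition thread (r : rel (edge Q)) (h : qpath) : bool :=
  if h.2 : seq _ is a :: p then
    [&& src a == h.1, path r a p, uniq (a :: p),
        [forall b, r (last a p) b ==> (b \in a :: p)]
      & [forall b, r b a ==> (b \in a :: p)]]
  else
    [&& #|[set b | src b == h.1]| <= 1, #|[set b | tgt b == h.1]| <= 1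
      & [forall b, forall c, (tgt b == h.1) && (src c == h.1) ==> r b c]].

Definition permitted_thread := thread permitted_step.
Definition forbidden_thread := thread forbidden_step.

(* The sign functions (sigma, epsilon), the signs being booleans. For arrows  *)
(* b, c that are the only ones with tgt b = src c and such that bc is a       *)
(* relation, the last clause is what makes the sign of the trivial forbidden  *)
(* thread at this vertex independent of the arrow used to define it.          *)
Definition signs := ({ffun edge Q -> bool} * {ffun edge Q -> bool})%type.

Definition sign_functions (s : signs) : bool :=
  [forall b, forall c,
    [&& (b != c) && (src b == src c) ==> (s.1 b != s.1 c),
        (b != c) && (tgt b == tgt c) ==> (s.2 b != s.2 c)
      & (tgt b == src c) ==> ((s.1 c == s.2 b) == zero b c)]].

Section Signs.

Variable s : signs.

Definition trivial_permitted_sigma v : bool :=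
  if [pick c | src c == v] is Some c then ~~ s.1 c
  else if [pick c | tgt c == v] is Some c then s.2 c else true.

Definition trivial_forbidden_sign v : bool :=
  if [pick c | src c == v] is Some c then ~~ s.1 c
  else if [pick c | tgt c == v] is Some c then ~~ s.2 c else true.

Definition permitted_sigma (h : qpath) : bool :=
  if h.2 : seq _ is a :: _ then s.1 a else trivial_permitted_sigma h.1.
Definition permitted_epsilon (h : qpath) : bool :=
  if h.2 : seq _ is a :: p then s.2 (last a p) else ~~ trivial_permitted_sigma h.1.
Definition forbidden_sigma (h : qpath) : bool :=
  if h.2 : seq _ is a :: _ then s.1 a else trivial_forbidden_sign h.1.
Definition forbidden_epsilon (h : qpath) : bool :=
  if h.2 : seq _ is a :: p then s.2 (last a p) else trivial_forbidden_sign h.1.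

(* One step H, F, H' of the algorithm: F is the forbidden thread that ends    *)
(* where the permitted thread H does, with the opposite epsilon, and H' is    *)
(* the permitted thread that starts where F does, with the opposite sigma.    *)
Definition ends_with (H F : qpath) : bool :=
  [&& permitted_thread H, forbidden_thread F, path_end H == path_end F
    & permitted_epsilon H != forbidden_epsilon F].
Definition starts_with (F H' : qpath) : bool :=
  [&& forbidden_thread F, permitted_thread H', path_start F == path_start H'
    & forbidden_sigma F != permitted_sigma H'].
Definition ag_step : rel qpath :=
  [rel H H' | [exists F, ends_with H F && starts_with F H']].

(* The set of the permitted threads H_0, ..., H_(n-1) of a run. *)
Definition ag_runs : {set {set qpath}} :=
  [set [set H' | connect ag_step H H'] | H in permitted_thread].

Definition ag_pair (R : {set qpath}) : nat * nat :=
  (#|R|, \sum_(F : qpath | [exists H in R, ends_with H F]) size F.2).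

(* The sets of arrows of the oriented cycles with full relations. *)
Definition zero_cycles : {set {set edge Q}} :=
  [set C | [exists p : #|edge Q|.-bseq (edge Q),
     [&& (p : seq _) != [::], uniq p, cycle forbidden_step p
       & C == [set a in (p : seq _)]]]].

Definition ag_count (n m : nat) : nat :=
  #|[set R in ag_runs | ag_pair R == (n, m)]|
  + #|[set C in zero_cycles | (0, #|C|) == (n, m)]|.

End Signs.

(* The count does not depend on the sign functions. *)
Definition AG (n m : nat) : nat :=
  if [pick s | sign_functions s] is Some s then ag_count s n m else 0.

End AG.

Section SurfaceAlgebra.

Variables (S : surface) (d : arrow S -> int).

(* The gentle presentation of the degree zero part of Jac(Q, W): the paths    *)
(* in the arrows of degree 0 that contain no path of length 2 of a 3-cycle.   *)
Definition surface_algebra : bound_quiver :=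
  @BoundQuiver (arc S) {a : arrow S | d a == 0%R}
    (fun a => arrow_src (val a)) (fun a => arrow_tgt (val a))
    (fun a b => follows_in_triangle (val a) (val b)).

(* The bijection of David-Roesler and Schiffler between the boundary          *)
(* components and the ordered pairs of the AG-invariant of the surface        *)
(* algebra, B corresponding to nm B.                                          *)
Definition AG_correspondence (nm : component S -> nat * nat) : Prop :=
  (forall n m, AG surface_algebra n m = #|[set B | nm B == (n, m)]|) /\
  (forall B, nm B = (incident_points B + local_cuts d B,
                     incident_segments B + 2 * local_cuts d B)).

End SurfaceAlgebra.

(* Main.v *)
Require Import Defs.
From mathcomp Require Import all_boot all_order all_algebra.
From mathcomp Require Import zify ring.

(******************************************************************************)
(* Call an ear a triangle with two sides on the boundary; the marked points   *)
(* incident to no arc are the tips of the ears. If there are u of them on B,  *)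
(* then n(B, Delta) = p - u and, S not being a disc, m(B, Delta) = p - 2u, so *)
(* the two equations amount to d(c) = l - u, where l counts the local cuts.   *)
(*   The curve which follows B closely crosses all the angles at the points   *)
(* of B, whence degree l; but it makes a backtrack in each ear. Give each     *)
(* backtrack the degree -1. If an ear is cut off along its arc, the curve of  *)
(* the new boundary arises by deletion of that backtrack, and the degree is   *)
(* the same: if the next triangle is internal, its angles a and b are         *)
(* replaced with the inverse of its third angle c, and a + b - 1 = -c; if it  *)
(* has a side on the boundary, it becomes an ear, the new backtrack replacing *)
(* the old one. As S is not a disc, this ends with a curve without backtracks *)
(* of degree l - u, and a cyclic word has only one reduced form.              *)
(******************************************************************************)

(** In terms of the lemmas: the degree of a cyclic word of crossings is a [weight], a sum over
    successive letters. Reduced forms of one word have equal weights ([reduces_weight]), hence so do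
    those of homotopic curves ([homotopic_weight]); as [c B] is reduced, its degree can be computed
    on any reduced form of the collar curve. For [crossing_weight], where a backtrack counts -1,
    this is the weight of the collar curve itself: [weight_normal_form] cuts off ears one at a time,
    [weight_collar_cut] is the local computation, and [collapsed_disc] ensures that the process does
    not consume the whole surface. The weight of the collar curve is read off term by term
    ([weight_collar]) as local cuts minus ears, and [card_incident_points] and
    [card_incident_segments] relate the ears to the two entries of the AG pair. *)

Set Implicit Arguments.
Unset Strict Implicit.
Unset Printing Implicit Defensive.

Import GRing.Theory.

(** * Reduction of cyclic words *)

Section CyclicWords.

Variables (T : eqType) (g : T -> T).
Hypothesis gK : involutive g.
Implicit Types (x y : T) (c a b r s : seq T).

Definition backtracks c := if c is x :: y :: _ then y == g x else false.

Definition reduced c := forall n, ~~ backtracks (rot n c).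

Inductive reduces : seq T -> seq T -> Prop :=
| ReducesRefl c : reduces c c
| ReducesStep n x c c' r :
    rot n c = [:: x, g x & c'] -> reduces c' r -> reduces c r.

Lemma rot_rot_ex m n c : exists k, rot m (rot n c) = rot k c.
Proof. by exists (rot_add c n m); rewrite rot_rot_add. Qed.

Lemma rot_sym n c : exists k, c = rot k (rot n c).
Proof. by exists (size (rot n c) - n); rewrite -[RHS]/(rotr n _) rotK. Qed.

Lemma reduced_rot n c : reduced c -> reduced (rot n c).
Proof. by move=> rc m; have [k ->] := rot_rot_ex m n c. Qed.

Lemma backtracksP c :
  backtracks c -> exists x c', c = [:: x, g x & c'].
Proof. by case: c => [|x [|y c]] //= /eqP ->; exists x, c. Qed.

Lemma reduced_dec c : reduced c \/ exists n, backtracks (rot n c).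
Proof.
have [/hasP[n _ cn]|/hasPn rc] :=
  boolP (has (fun n => backtracks (rot n c)) (iota 0 (size c).+1)).
  by right; exists n.
by left=> n; rewrite rot_minn; apply: rc; rewrite mem_iota /= add0n ltnS geq_minr.
Qed.

Lemma reduced_cycle c : cycle [rel x y | y != g x] c -> reduced c.
Proof.
move=> cyc_c n; move: cyc_c; rewrite -(rot_cycle n).
by case: (rot n c) => [|x [|y c']] //= /andP[].
Qed.

Lemma normal_form_ex c : exists2 r, reduces c r & reduced r.
Proof.
have [N leN] := ubnP (size c); elim: N c leN => // N IH c leN.
have [rc|[n /backtracksP[x [c' def_c]]]] := reduced_dec c.
  by exists c => //; apply: ReducesRefl.
have size_c: size c = (size c').+2 by rewrite -(size_rot n) def_c.
have [|r c'r rr] := IH c'; first by lia.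
by exists r => //; apply: ReducesStep def_c c'r.
Qed.

(* Two disjoint backtracks can be deleted in either order; for overlapping    *)
(* ones x, g x, x the two deletions give rotations of the same word.          *)
Lemma backtracks_confluent n x a m y b c :
    rot n c = [:: x, g x & a] -> rot m c = [:: y, g y & b] ->
  (exists k, b = rot k a) \/
  exists2 e, (exists i z, rot i a = [:: z, g z & e])
    & exists j w f, rot j b = [:: w, g w & f] /\ exists k, f = rot k e.
Proof.
move=> def_a def_b.
have{c def_a def_b} [k]: exists k, rot k [:: x, g x & a] = [:: y, g y & b].
  have [i ci] := rot_sym n c; rewrite {}ci def_a in def_b.
  by have [k def_k] := rot_rot_ex m i [:: x, g x & a]; exists k; rewrite -def_k.
(* [k] is the offset between the two backtracks: equal for 0, overlapping for 1. Beyond that, [d] is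
   what remains of [a] from the second backtrack on; if [d] has at most one letter, the second
   backtrack wraps around to the first. *)
case: k => [|[|k]].
- by rewrite rot0 => -[_ _ ->]; left; exists 0; rewrite rot0.
- rewrite rot1_cons; case: a => [|z a] /=; first by case=> _ _ <-; left; exists 0.
  by case=> <- -> <-; left; exists 1; rewrite gK rot1_cons.
have -> : rot k.+2 [:: x, g x & a] = drop k a ++ [:: x, g x & take k a] by [].
move: (cat_take_drop k a).
move: (take k a) (drop k a) => a' d <-; case: d => [|z [|w d]] /=.
- by case=> _ _ <-; left; exists 0; rewrite rot0 cats0.
- case=> -> -> <-; rewrite gK; left; exists (size a').
  by rewrite rot_size_cat.
case=> -> -> <-; right; exists (d ++ a').
  by exists (size a'), y; rewrite rot_size_cat.
exists (size d), x, (a' ++ d); rewrite rot_size_cat; split=> //.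
by exists (size d); rewrite rot_size_cat.
Qed.

Section Weight.

Variable F : T -> T -> int.

Definition weight c : int := (\sum_(s <- zip c (rot 1 c)) F s.1 s.2)%R.

Lemma weight_cat a b : weight (a ++ b) = weight (b ++ a).
Proof.
have zip_cat' x p y q z : zip (x :: p ++ y :: q) (rcons (p ++ y :: q) z) =
    zip (x :: p) (rcons p y) ++ zip (y :: q) (rcons q z).
  by elim: p x => [|w p IH] x //=; rewrite IH.
rewrite /weight; case: a => [|x a]; first by rewrite cats0.
case: b => [|y b]; first by rewrite cats0.
by rewrite !cat_cons !rot1_cons !zip_cat' !big_cat [LHS]addrC.
Qed.

Lemma weight_rot n c : weight (rot n c) = weight c.
Proof. by rewrite /rot weight_cat cat_take_drop. Qed.

(** Newman's argument, by induction on the length: local confluence is [backtracks_confluent]. The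
    rotation [k] is needed because deleting one or the other of two overlapping backtracks gives the
    same word only up to rotation. *)
Lemma reduces_weight c k r r' :
    reduces c r -> reduces (rot k c) r' -> reduced r -> reduced r' ->
  weight r = weight r'.
Proof.
have [N leN] := ubnP (size c); elim: N c leN k r r' => // N IH c leN k r r' cr.
case: cr leN => {c r} [c _|n x c a r def_a ar leN].
  move def_c': (rot k c) => c' c'r' rc; case: c'r' def_c' => {c' r'}.
    by move=> _ <-; rewrite weight_rot.
  move=> n x c' a r' def_a _ def_c'; have := reduced_rot k rc n.
  by rewrite def_c' def_a /= eqxx.
move def_c': (rot k c) => c' c'r' rr rr'.
case: c'r' def_c' rr' => {c' r'}[_ <- rr'|m y c' b r' def_b br' def_c' rr'].
  have [i def_c] := rot_sym k c; have := rr' (rot_add (rot k c) i n).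
  by rewrite -rot_rot_add -def_c def_a /= eqxx.
have [i def_i] := rot_rot_ex m k c; rewrite -def_c' def_i in def_b.
have size_c j z d : rot j c = [:: z, g z & d] -> size c = (size d).+2.
  by move=> def_d; rewrite -(size_rot j) def_d.
have lta: size a < N by have := size_c _ _ _ def_a; lia.
have ltb: size b < N by have := size_c _ _ _ def_b; lia.
have [[j def_j]|] := backtracks_confluent def_a def_b.
  by apply: (IH _ lta j _ _ ar _ rr rr'); rewrite -def_j.
case=> e [j [z def_e]] [j' [w [f [def_f [j'' def_j'']]]]].
have lte: size e < N.
  by have := congr1 size def_e; rewrite size_rot /=; lia.
(* The diamond is closed by reduced forms: [r] and [s] both come from [a], [s] and [s'] from
   rotations of [e], [s'] and [r'] from [b]. *)
have [s es rs] := normal_form_ex e; have [s' fs' rs'] := normal_form_ex f.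
transitivity (weight s).
  by apply: (IH _ lta 0 _ _ ar _ rr rs); rewrite rot0; apply: ReducesStep def_e es.
transitivity (weight s').
  by apply: (IH _ lte j'' _ _ es _ rs rs'); rewrite -def_j''.
by apply: (IH _ ltb 0 _ _ (ReducesStep def_f fs') _ rs' rr'); rewrite rot0.
Qed.

End Weight.

End CyclicWords.

(** * First return of an orbit to a subset *)

Section ThirdIterate.

Variables (T : eqType) (P : pred T) (f : T -> T).

(** The first return map to [P], when the return takes at most three steps. A collar meets at most
    two boundary sides in a triangle between two crossings, so three steps suffice. *)
Definition next3 x :=
  if P (f x) then f x else if P (f (f x)) then f (f x) else f (f (f x)).

Hypothesis P3 : forall x, P x ->
  [|| P (f x), P (f (f x)) | P (f (f (f x)))].

Lemma fpath_filter x p :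
  P x -> fpath f x p -> P (last x p) -> fpath next3 x (filter P p).
Proof.
have [N leN] := ubnP (size p); elim: N p leN x => // N IH p leN x Px.
case: p leN => //= y p lt1 /andP[/eqP<- {y} fp]; have [P1|P1] /= := boolP (P (f x)).
  by move=> Pp; rewrite {1}/next3 P1 eqxx IH.
case: p lt1 fp => /= [|z p] lt2; first by rewrite (negPf P1).
case/andP=> /eqP<- {z} fp; have [P2|P2] /= := boolP (P (f (f x))).
  by move=> Pp; rewrite {1}/next3 (negPf P1) P2 eqxx IH // ltnW.
case: p lt2 fp => /= [|t p] lt3; first by rewrite (negPf P2).
case/andP=> /eqP<- {t} fp Pp; have := P3 Px; rewrite (negPf P1) (negPf P2) /= => P3x.
rewrite P3x /= {1}/next3 (negPf P1) (negPf P2) eqxx IH //.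
by do 2![apply: ltnW].
Qed.

Lemma filter_rot n c : exists k, filter P (rot n c) = rot k (filter P c).
Proof.
exists (size (filter P (take n c))).
have -> : filter P c = filter P (take n c) ++ filter P (drop n c).
  by rewrite -filter_cat cat_take_drop.
by rewrite rot_size_cat /rot filter_cat.
Qed.

Lemma fcycle_filter c : fcycle f c -> fcycle next3 (filter P c).
Proof.
have [/hasP[x cx Px]|noP] := boolP (has P c); last first.
  by rewrite has_filter negbK in noP; rewrite (eqP noP).
have [i s def_s] := rot_to cx; rewrite -(rot_cycle i) def_s => /= fs.
have [k def_k] := filter_rot i c; rewrite -(rot_cycle k) -def_k def_s /= Px /=.
by have := fpath_filter Px fs; rewrite last_rcons filter_rcons Px; apply.
Qed.

End ThirdIterate.

Lemma weight_fcycle (T : eqType) (F : T -> T -> int) f c :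
  fcycle f c -> weight F c = (\sum_(x <- c) F x (f x))%R.
Proof.
suff fpE x p y : fpath f x (rcons p y) ->
    (\sum_(s <- zip (x :: p) (rcons p y)) F s.1 s.2 =
     \sum_(z <- x :: p) F z (f z))%R.
  by case: c => [|x p] fc; rewrite /weight ?big_nil // rot1_cons fpE.
elim: p x => [|z p IH] x /= /andP[/eqP<-]; first by rewrite !big_seq1.
by move=> fp; rewrite big_cons IH // [RHS]big_cons.
Qed.

Lemma eq_weight_cycle (T : eqType) (F F' : T -> T -> int) (e : rel T) c :
  (forall x y, e x y -> F x y = F' x y) -> cycle e c -> weight F c = weight F' c.
Proof.
move=> eqF; suff eq_path x p y : path e x (rcons p y) ->
    (\sum_(s <- zip (x :: p) (rcons p y)) F s.1 s.2 =
     \sum_(s <- zip (x :: p) (rcons p y)) F' s.1 s.2)%R.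
  by case: c => [|x p] ep; rewrite /weight ?big_nil // rot1_cons eq_path.
elim: p x => [|z p IH] x /= /andP[xz ep]; first by rewrite !big_seq1 /= eqF.
by rewrite !big_cons IH ?eqF.
Qed.

Lemma orbit_fcycle (T : finType) (f : T -> T) x p :
  fcycle f (x :: p) -> uniq (x :: p) -> orbit f x = x :: p.
Proof.
by move=> fp up; rewrite (orbitE fp up (mem_head x p)) /= eqxx rot0.
Qed.

(** * Cutting off ears *)

(* g is the gluing of the surface; h stands for the gluing left after some    *)
(* ears have been cut off, so that h x is x or g x.                           *)
Section Peeling.

Variables (T : finType) (n g : T -> T).
Hypothesis n3 : forall x, n (n (n x)) = x.
Hypothesis n_neq : forall x, n x != x.
Implicit Types (h : T -> T) (x y z : T).

Definition turn_by h x := n (h x).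

Definition collar h x := [seq y <- orbit (turn_by h) x | h y != y].

Definition next_crossing h := next3 (fun y => h y != y) (turn_by h).

(* The component of x is a disc: its dual graph, with #|K| / 3 vertices and    *)
(* one edge for each pair of sides of an arc, is a tree.                      *)
Definition collapsed h x : Prop :=
  exists K : {set T},
    [/\ x \in K, forall y, y \in K -> (n y \in K) && (h y \in K),
        {subset K <= orbit (turn_by h) x}
      & 2 * #|K| = 3 * #|[set y in K | h y != y]| + 6].

Lemma n_inj : injective n.
Proof. by move=> x y nxy; rewrite -[x]n3 nxy n3. Qed.

Lemma nn_neq x : n (n x) != x.
Proof. by apply: contra (n_neq x) => /eqP nnx; rewrite -{1}nnx n3. Qed.

Section Glue.

Variable h : T -> T.
Hypothesis hK : involutive h.

Lemma turn_by_inj : injective (turn_by h).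
Proof. by move=> x y /n_inj/(can_inj hK). Qed.

Lemma orbit_turn_by_rot x y : y \in orbit (turn_by h) x ->
  exists k, orbit (turn_by h) y = rot k (orbit (turn_by h) x).
Proof.
move=> xy; have inj := turn_by_inj.
have [k ->] := orbit_rot_cycle (cycle_orbit inj x) (orbit_uniq _ x) xy.
by exists k.
Qed.

Lemma mem_orbit_turn_by x y : y \in orbit (turn_by h) x ->
  orbit (turn_by h) y =i orbit (turn_by h) x.
Proof. by move=> /orbit_turn_by_rot[k ->] z; rewrite mem_rot. Qed.

Lemma orbit_closed_sub (A : {pred T}) x : x \in A ->
  (forall z, z \in A -> turn_by h z \in A) -> {subset orbit (turn_by h) x <= A}.
Proof.
by move=> Ax closedA _ /trajectP[i _ ->]; elim: i => //= i; apply: closedA.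
Qed.

Lemma collapsed_base x y : y \in orbit (turn_by h) x ->
  collapsed h y -> collapsed h x.
Proof.
move=> xy [K [Ky closedK subK cardK]]; exists K; split=> //; last first.
  by move=> z /subK; rewrite (mem_orbit_turn_by xy).
apply: (orbit_closed_sub Ky) => [z /closedK/andP[_ /closedK/andP[]] //|].
by rewrite (mem_orbit_turn_by xy) in_orbit.
Qed.

Lemma collapsed_triangle x :
  h x = x -> h (n x) = n x -> h (n (n x)) = n (n x) -> collapsed h x.
Proof.
move=> h0 h1 h2; exists [set x; n x; n (n x)]; split.
- by rewrite !inE eqxx.
- move=> y; rewrite !inE.
  by case/orP=> [/orP[]|] /eqP->; rewrite ?h0 ?h1 ?h2 ?n3 !eqxx ?orbT.
- have mem_turn y : y \in orbit (turn_by h) x -> h y = y ->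
    n y \in orbit (turn_by h) x by move=> /mem_orbit; rewrite /turn_by => + <-.
  have x0 := in_orbit (turn_by h) x; have x1 := mem_turn _ x0 h0.
  have x2 := mem_turn _ x1 h1.
  by move=> y; rewrite !inE => /orP[/orP[]|] /eqP->.
have -> : [set y in [set x; n x; n (n x)] | h y != y] = set0.
  apply/setP=> y; rewrite !inE; apply/negP => /andP[/orP[/orP[]|] /eqP->];
  by rewrite ?h0 ?h1 ?h2 eqxx.
rewrite cards0 setUC cardsU1 cards2 !inE (inj_eq n_inj) (negPf (nn_neq x)).
by rewrite (negPf (n_neq x)) (eq_sym x) n_neq.
Qed.

(** The triangle is entered through [h x] and left through the first later side that is an arc. The
    last case, where the other two sides are on the boundary, is the backtrack in an ear. *)
Lemma next_crossingE x : h x != x ->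
  next_crossing h x =
    if h (n (h x)) != n (h x) then n (h x)
    else if h (n (n (h x))) != n (n (h x)) then n (n (h x)) else h x.
Proof.
move=> hx; rewrite /next_crossing /next3 /turn_by.
case: (eqVneq (h (n (h x))) (n (h x))) => //= ->.
by case: (eqVneq (h (n (n (h x)))) (n (n (h x)))) => //= ->; rewrite n3.
Qed.

Lemma fcycle_collar x : fcycle (next_crossing h) (collar h x).
Proof.
apply: fcycle_filter; last exact: (cycle_orbit turn_by_inj).
move=> y hy; rewrite /turn_by.
have [->|//] /= := eqVneq (h (n (h y))) (n (h y)).
by have [->|//] /= := eqVneq (h (n (n (h y)))) (n (n (h y))); rewrite n3 hK eq_sym.
Qed.

Lemma collar_rot x y : y \in orbit (turn_by h) x ->
  exists k, collar h y = rot k (collar h x).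
Proof. by move=> /orbit_turn_by_rot[k def_y]; rewrite /collar def_y; apply: filter_rot. Qed.

End Glue.

(* b and n b are the boundary sides of an ear, y is the side of its arc in    *)
(* the next triangle.                                                         *)
Section Cut.

Variables (h : T -> T) (b : T).
Hypothesis hK : involutive h.
Let e := n (n b).
Let y := h e.
Hypotheses (hb : h b = b) (hnb : h (n b) = n b) (he : y != e).

(** The ear is not removed but becomes a component of its own, so that the type of sides stays the
    same. *)
Definition cut_glue x := if (x == y) || (x == e) then x else h x.

Lemma cut_glueK : involutive cut_glue.
Proof.
move=> x; rewrite /cut_glue; case xye: ((x == y) || (x == e)); first by rewrite xye.
have -> : (h x == y) = (x == e) by rewrite (inj_eq (can_inj hK)).
by rewrite (inv_eq hK x e) orbC xye hK.
Qed.

Lemma cut_glue_out x : x != y -> x != e -> cut_glue x = h x.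
Proof. by rewrite /cut_glue => /negPf-> /negPf->. Qed.

Lemma cut_glue_y : cut_glue y = y.
Proof. by rewrite /cut_glue eqxx. Qed.

Lemma cut_glue_ear x : x \in [:: b; n b; e] -> cut_glue x = x.
Proof.
by rewrite /cut_glue !inE => /or3P[] /eqP->; case: ifP; rewrite ?eqxx ?orbT.
Qed.

Lemma glue_y : h y = e.
Proof. exact: hK. Qed.

Lemma y_notin_ear : y \notin [:: b; n b; e].
Proof.
have hy : h y != y by rewrite glue_y eq_sym.
rewrite !inE (negPf he) orbF negb_or.
by apply/andP; split; apply: contra hy => /eqP->; apply/eqP.
Qed.

Lemma cut_glue_arc x : (cut_glue x != x) = [&& x != y, x != e & h x != x].
Proof. by rewrite /cut_glue; case: (x == y); case: (x == e); rewrite ?eqxx. Qed.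

(** With the ear attached, turning from [y] runs through the sides [b], [n b], [e] of the ear before
    reaching [n y]; after the cut it goes to [n y] at once. *)
Lemma orbit_cut : exists p,
  orbit (turn_by cut_glue) y = y :: p /\ orbit (turn_by h) y = [:: y, b, n b, e & p].
Proof.
have inj := turn_by_inj cut_glueK.
have [p def_o] : exists p, orbit (turn_by cut_glue) y = y :: p.
  by rewrite /orbit -orderSpred /=; eexists.
exists p; split=> //; have := orbit_uniq (turn_by cut_glue) y.
have := cycle_orbit inj y; rewrite def_o => fp /= /andP[py up].
(* The detached ear is closed under turning, so the orbit of [y] avoids it. *)
have p_ear : all [predC [:: b; n b; e]] p.
  apply/allP=> x px /=; apply: contra y_notin_ear => ear_x.
  have ox : x \in orbit (turn_by cut_glue) y by rewrite def_o inE px orbT.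
  apply: (orbit_closed_sub ear_x) (_ : y \in orbit (turn_by cut_glue) x).
    move=> z ear_z.
    rewrite /turn_by cut_glue_ear //; move: ear_z; rewrite !inE.
    by case/or3P=> /eqP->; rewrite ?eqxx ?orbT // [n e]n3 eqxx.
  by rewrite (mem_orbit_turn_by cut_glueK ox) in_orbit.
apply: orbit_fcycle; last first.
  rewrite !cons_uniq up andbT.
  have notp x : x \in [:: b; n b; e] -> x \notin p.
    by move=> ear_x; apply/negP=> /(allP p_ear) /=; rewrite ear_x.
  rewrite (_ : [:: b, n b, e & p] = [:: b; n b; e] ++ p) // mem_cat negb_or.
  rewrite y_notin_ear py /= !inE !negb_or !notp ?inE ?eqxx ?orbT // !andbT.
  by rewrite [b == n b]eq_sym [b == e]eq_sym [n b == e]eq_sym !(negPf (n_neq _)) (negPf (nn_neq _)).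
have turn_y : turn_by h y = b by rewrite /turn_by glue_y n3.
have turn_b : turn_by h b = n b by rewrite /turn_by hb.
have turn_nb : turn_by h (n b) = e by rewrite /turn_by hnb.
have turn_e : turn_by h e = n y by [].
case: p => [|z p] in fp py p_ear {def_o up} *.
  by move: fp; rewrite /= /turn_by cut_glue_y (negPf (n_neq y)).
move: fp; rewrite /= turn_y turn_b turn_nb turn_e !eqxx /= => /andP[].
rewrite {1}/turn_by cut_glue_y => ->; rewrite !rcons_path.
have turn_p x : x \in z :: p -> turn_by cut_glue x = turn_by h x.
  move=> px; rewrite /turn_by cut_glue_out //; first by apply: contraNneq py => <-.
  by apply: contraTneq px => ->; apply/negP => /(allP p_ear); rewrite !inE eqxx !orbT.
rewrite /= turn_p ?mem_last // => /andP[+ ->]; rewrite andbT.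
apply: (sub_in_path (P := mem (z :: p))) => [x t /turn_p /= -> //|].
exact/allP.
Qed.

Lemma collar_cut : collar h y = [:: y, e & collar cut_glue y].
Proof.
have [p [def_o' def_o]] := orbit_cut; rewrite /collar def_o def_o' /=.
rewrite hb hnb -/y glue_y (eq_sym e) he cut_glue_y !eqxx /=; congr [:: _, _ & _].
have := orbit_uniq (turn_by h) y; rewrite def_o /= !inE.
rewrite !negb_or => /and5P[/and4P[_ _ _ py] _ _ ep _].
apply: eq_in_filter => x px; rewrite cut_glue_arc.
have -> /= : x != y by apply: contraNneq py => <-.
by have -> : x != e by apply: contraNneq ep => <-.
Qed.

Lemma card_cut : #|[set x | cut_glue x != x]| < #|[set x | h x != x]|.
Proof.
apply/proper_card/properP; split.
  by apply/subsetP=> x; rewrite !inE cut_glue_arc => /and3P[].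
by exists y; rewrite !inE ?cut_glue_y ?eqxx // glue_y eq_sym.
Qed.

(** Gluing the ear back adds three sides to [K] and turns [y] and [e] into sides of an arc; both
    members of the count grow by 6. *)
Lemma collapsed_cut : collapsed cut_glue y -> collapsed h y.
Proof.
have [p [def_o' def_o]] := orbit_cut.
have u_o := orbit_uniq (turn_by h) y; rewrite def_o in u_o.
case=> K [Ky closedK subK cardK]; pose t := [set b; n b; e].
have tP x : (x \in t) = (x \in [:: b; n b; e]) by rewrite !inE -orbA.
have Kt x : x \in K -> x \notin t.
  move=> /subK; rewrite def_o' tP inE => /orP[/eqP->|px]; first exact: y_notin_ear.
  apply/negP => tx; move: u_o.
  rewrite -[_ :: _]/([:: y] ++ [:: b; n b; e] ++ p) cat_uniq => /and3P[_ _].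
  by rewrite cat_uniq => /and3P[_ /hasPn/(_ x px)/negP[]].
have Ke x : x \in K -> x != e.
  by move=> /Kt; apply: contraNneq => ->; rewrite !inE eqxx orbT.
exists (t :|: K); split.
- by rewrite inE Ky orbT.
- move=> x; rewrite in_setU => /orP[|Kx].
    rewrite tP !inE => /or3P[] /eqP->.
    + by rewrite hb !eqxx ?orbT.
    + by rewrite hnb !eqxx ?orbT.
    + by rewrite [n e]n3 Ky eqxx !orbT.
  have /andP[Knx Khx] := closedK x Kx; rewrite !in_setU Knx orbT /=.
  have [->|xy] := eqVneq x y; first by rewrite glue_y !inE eqxx orbT.
  by rewrite -cut_glue_out ?Ke // Khx orbT.
- move=> x; rewrite in_setU def_o => /orP[|/subK]; rewrite ?def_o'.
    by rewrite tP !inE => /or3P[] ->; rewrite ?orbT.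
  by rewrite !inE => /orP[] ->; rewrite ?orbT.
have -> : [set x in t :|: K | h x != x] = [set y; e] :|: [set x in K | cut_glue x != x].
  apply/setP=> x; rewrite !inE cut_glue_arc.
  have [->|xy] /= := eqVneq x y; first by rewrite Ky glue_y (eq_sym e) he !orbT.
  have [->|xe] /= := eqVneq x e; first by rewrite -/y he !orbT.
  rewrite orbF; case: eqVneq => [->|_]; first by rewrite hb eqxx !andbF.
  by case: eqVneq => [->|_]; first by rewrite hnb eqxx !andbF.
have disj (A B : {set T}) : (forall x, x \in A -> x \notin B) -> #|A :|: B| = #|A| + #|B|.
  move=> AB; rewrite cardsU (_ : A :&: B = set0) ?cards0 ?subn0 //.
  by apply/setP=> x; rewrite !inE; apply/negP=> /andP[/AB/negP].
have card_t : #|t| = 3.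
  rewrite /t setUC cardsU1 cards2 !inE (inj_eq n_inj) (negPf (nn_neq b)).
  by rewrite (negPf (n_neq b)) (eq_sym b) n_neq.
rewrite [t :|: K]setUC disj // disj ?cards2 ?he ?card_t /=; last first.
  by move=> x; rewrite !inE cut_glue_arc => /orP[] /eqP->; rewrite eqxx ?andbF.
by move: cardK; lia.
Qed.

End Cut.

(** * Invariance of the degree when an ear is cut off *)

Section Turns.

Variable D : T -> int.
Local Open Scope ring_scope.

(** Degree of a segment entering a triangle through [x] and leaving through [z], where [D x] is the
    degree of the angle between [x] and [n x]. *)
Definition turn_weight x z : int :=
  (if z == n x then D x else 0) - (if x == n z then D z else 0).

(* z = g x is a backtrack. *)
Definition crossing_weight x z : int := turn_weight (g x) z - (z == g x)%:R.

Lemma turn_weight_next x : turn_weight x (n x) = D x.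
Proof. by rewrite /turn_weight eqxx eq_sym (negPf (nn_neq x)) subr0. Qed.

Lemma turn_weight_prev x : turn_weight (n x) x = - D x.
Proof. by rewrite /turn_weight eqxx eq_sym (negPf (nn_neq x)) sub0r. Qed.

Lemma turn_weight_refl x : turn_weight x x = 0.
Proof. by rewrite /turn_weight eq_sym (negPf (n_neq x)) subrr. Qed.

Lemma weight_cons F x p :
  weight F (x :: p) = \sum_(s <- zip (belast x p) p) F s.1 s.2 + F (last x p) x.
Proof.
have zipE z : zip (x :: p) (rcons p z) = rcons (zip (belast x p) p) (last x p, z).
  by elim: p x => //= y p IH x; rewrite IH.
by rewrite /weight rot1_cons zipE big_rcons.
Qed.

Hypothesis D3 : forall x, g x != x -> g (n x) != n x -> g (n (n x)) != n (n x) ->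
  D x + D (n x) + D (n (n x)) = 1.

(** Only the crossings next to the ear matter: a passage [z, y, e, w] becomes [z, w]. The last
    hypothesis guarantees that the triangle of [y] has another arc, so that [z] and [w] exist. *)
Lemma weight_collar_cut h b (e := n (n b)) (y := h e) :
  involutive h -> (forall x, h x = x \/ h x = g x) ->
  h b = b -> h (n b) = n b -> y != e ->
  ~~ ((h (n y) == n y) && (h (n (n y)) == n (n y))) ->
  weight crossing_weight (collar h y) =
    weight crossing_weight (collar (cut_glue h b) y).
Proof.
move=> hK hg hb hnb he not_ear; rewrite collar_cut //.
have hy : h y = e := hK e.
have arc_g x : h x != x -> g x = h x by case: (hg x) => ->; rewrite ?eqxx.
set h' := cut_glue h b; set q := collar h' y.
have fq : fcycle (next_crossing h') q by exact/fcycle_collar/cut_glueK.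
have fyq : fcycle (next_crossing h) [:: y, e & q].
  by rewrite -/(cut_glue h b) -collar_cut //; apply: fcycle_collar.
have q_arc x : x \in q -> h' x != x by rewrite mem_filter => /andP[].
have arc_e : h e != e by [].
have arc_y : h y != y by rewrite hy eq_sym.
have q_n : exists x, x \in q.
  have [ny_b ny_nb] : n y != e /\ n (n y) != e.
    have := y_notin_ear hK hb hnb he; rewrite !inE !negb_or -/e -/y.
    by rewrite /e !(inj_eq n_inj) => /and3P[].
  have mem_q x : x \in orbit (turn_by h') y -> x != y -> x != e -> h x != x -> x \in q.
    by move=> ox xy xe hx; rewrite mem_filter cut_glue_arc // xy xe hx.
  have o1 : n y \in orbit (turn_by h') y.
    by have := mem_orbit (in_orbit (turn_by h') y); rewrite {1}/turn_by [h' y]cut_glue_y.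
  have [fix_ny|arc_ny] := eqVneq (h (n y)) (n y); last by exists (n y); apply: mem_q.
  rewrite fix_ny eqxx /= in not_ear; exists (n (n y)); apply: mem_q => //.
    by have := mem_orbit o1; rewrite {1}/turn_by [h' _]cut_glue_out ?fix_ny.
  exact: nn_neq.
case: q => [|w s] in fq fyq q_arc q_n *; first by case: q_n.
rewrite !weight_cons /= !big_cons /= -/e -/y.
set z := last w s; set A := (\sum_(_ <- _) _).
move: fyq; rewrite /= rcons_path => /and4P[_ /eqP def_w _].
rewrite -/z => /eqP def_y.
move: fq; rewrite /= rcons_path => /andP[_]; rewrite -/z => /eqP _.
have /q_arc := mem_last w s; rewrite cut_glue_arc // -/z -/e -/y => /and3P[zy ze arc_z].
rewrite (next_crossingE arc_e) -/y in def_w.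
rewrite (next_crossingE arc_z) in def_y.
rewrite /crossing_weight !arc_g // hy -/y turn_weight_refl eqxx.
set a := h z in def_y *; have arc_a : h a != a by rewrite /a hK eq_sym.
have az : a != y by apply: contra ze => /eqP az; rewrite -[z]hK -/a az hy.
have Wn := turn_weight_next (n (n y)); rewrite n3 in Wn.
have Wp := turn_weight_prev (n (n y)); rewrite n3 in Wp.
have y_ny : (y == n y) = false by rewrite eq_sym (negPf (n_neq y)).
have y_nny : (y == n (n y)) = false by rewrite eq_sym (negPf (nn_neq y)).
(* The curve enters the triangle of [y] through [a] just before crossing [y]: [a] is the side
   preceding [y] if that is an arc, and the remaining side otherwise. *)
have def_a : a = n (n y) \/ a = n y /\ h (n (n y)) = n (n y).
  move: def_y; case: eqVneq => [hna|_] /= => [|<-]; last by left; rewrite n3.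
  case: eqVneq => _ /= => [ay|<-]; first by rewrite ay eqxx in az.
  by right; rewrite n3.
(* If the triangle of [y] has a boundary side, the two angles cancel and a backtrack remains on
   either side of the equation; if it is internal, [D3] applies. *)
move: def_w; case: eqVneq => [hny|arc_ny] /= => [|<-].
  rewrite hny eqxx /= in not_ear; rewrite not_ear => <-.
  case: def_a => [->|[def_a _]]; last by rewrite def_a hny eqxx in arc_a.
  rewrite Wp Wn turn_weight_refl y_nny (negPf (nn_neq y)) eqxx /=; ring.
case: def_a => [def_a|[-> _]].
  rewrite def_a Wn turn_weight_next turn_weight_prev y_nny (negPf (n_neq y)).
  rewrite (eq_sym (n y)) (negPf (n_neq _)).
  have := D3 (x := y); rewrite !arc_g -?def_a // => /(_ arc_y arc_ny arc_a).
  by move: (D y) (D (n y)) (D a) => d0 d1 d2 D3y; lia.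
rewrite turn_weight_next turn_weight_prev turn_weight_refl y_ny (negPf (n_neq y)) eqxx /=; ring.
Qed.

(** Induction on the number of sides of arcs for [h], while reduction always refers to [g]: as the
    two agree on the arcs of [h], the backtrack of an ear for [h] is one for [g]. *)
Lemma weight_normal_form h x r :
  involutive g -> involutive h -> (forall x, h x = x \/ h x = g x) -> ~ collapsed h x ->
  reduces g (collar h x) r -> reduced g r ->
  weight crossing_weight r = weight crossing_weight (collar h x).
Proof.
move=> gK; have [N leN] := ubnP #|[set x | h x != x]|.
elim: N h leN x r => // N IH h leN x r hK hg not_coll xr rr.
have arc_g z : h z != z -> g z = h z by case: (hg z) => ->; rewrite ?eqxx.
have nf_weight y k r' : collar h y = rot k (collar h x) ->
    reduces g (collar h y) r' -> reduced g r' ->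
    weight crossing_weight r = weight crossing_weight r'.
  move=> xy yr' rr'; apply: (reduces_weight gK (k := k) _ xr _ rr rr').
  by rewrite -xy.
have [/hasP[b ob /andP[/eqP hb /eqP hnb]]|/hasPn no_ear] :=
    boolP (has (fun b => (h b == b) && (h (n b) == n b)) (orbit (turn_by h) x)).
  pose e := n (n b); pose y := h e.
  have onb : n b \in orbit (turn_by h) x.
    by have := mem_orbit ob; rewrite /turn_by hb.
  have [e_bdry|arc_e] := eqVneq (h e) e.
    by case: not_coll; apply: (collapsed_base hK ob); apply: collapsed_triangle.
  have he : y != e by [].
  have hy : h y = e := hK e.
  have oy : y \in orbit (turn_by h) x.
    have yb : b \in orbit (turn_by h) y.
      by have := mem_orbit (in_orbit (turn_by h) y); rewrite {1}/turn_by hy n3.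
    by rewrite -(mem_orbit_turn_by hK ob) (mem_orbit_turn_by hK yb) in_orbit.
  have not_coll' : ~ collapsed (cut_glue h b) y.
    by move=> coll; apply/not_coll/(collapsed_base hK oy)/collapsed_cut.
  (* Otherwise the cut would leave a single triangle, which is collapsed. *)
  have not_ear : ~~ ((h (n y) == n y) && (h (n (n y)) == n (n y))).
    have cut_bdry z : h z = z -> cut_glue h b z = z.
      by move=> hz; apply/eqP; rewrite -[_ == _]negbK cut_glue_arc // hz eqxx !andbF.
    apply/andP=> -[/eqP hny /eqP hnny]; apply: not_coll'.
    by apply: collapsed_triangle; rewrite ?cut_glue_y // cut_bdry.
  have [k xy] := collar_rot hK oy.
  have [r' yr' rr'] := normal_form_ex g (collar (cut_glue h b) y).
  have hr' : reduces g (collar h y) r'.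
    apply: (ReducesStep (n := 0) (x := y) _ yr'); rewrite rot0 collar_cut // -/e -/y arc_g ?hy //.
    by rewrite eq_sym.
  rewrite (nf_weight _ _ _ xy hr' rr') -[RHS](weight_rot _ k) -xy.
  rewrite (weight_collar_cut hK hg hb hnb he not_ear).
  apply: IH yr' rr' => //.
  - exact: leq_trans (card_cut hK he) _.
  - exact: cut_glueK.
  - by move=> z; rewrite /cut_glue; case: ifP => _; [left|apply: hg].
(* Without an ear along the orbit, the collar is its own reduced form. *)
apply: (nf_weight x 0) => //; first by rewrite rot0.
  exact: ReducesRefl.
apply: reduced_cycle; have := fcycle_collar hK x.
apply: (sub_in_cycle (P := mem (collar h x))); last exact/allP.
move=> z t /= + _ => /[!mem_filter] /andP[arc_z oz] /eqP<-.
rewrite arc_g // next_crossingE //; case: ifP => [_|/eqP h1]; first exact: n_neq.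
case: ifP => [_|/eqP h2]; first exact: nn_neq.
by have := no_ear _ (mem_orbit oz); rewrite /turn_by h1 h2 !eqxx.
Qed.

End Turns.
End Peeling.

Lemma homotopic_weight (S : surface) (F : side S -> side S -> int) c c' :
  homotopic c c' -> forall r r', reduces (@glue S) c r -> reduced (@glue S) r ->
  reduces (@glue S) c' r' -> reduced (@glue S) r' -> weight F r = weight F r'.
Proof.
have gK := @glue_involutive S; elim=> {c c'}
  [c c' [n {}c _|x {}c _]|c|c c' _ IH|c1 c2 c3 _ IH1 _ IH2] r r' cr rr cr' rr'.
- exact: (reduces_weight gK _ cr cr' rr rr').
- apply: (reduces_weight gK (k := 0) _ cr _ rr rr'); rewrite rot0.
  by apply: (ReducesStep (n := 0) _ cr'); rewrite rot0.
- by apply: (reduces_weight gK (k := 0) _ cr _ rr rr'); rewrite rot0.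
- exact/esym/IH.
have [r2 cr2 rr2] := normal_form_ex (@glue S) c2.
by rewrite (IH1 r r2) // (IH2 r2 r').
Qed.

Lemma card_imset_fibers (T U : finType) (f : T -> U) (A : {pred T}) k :
  (forall x, x \in A -> #|[set y in A | f y == f x]| = k) ->
  #|A| = k * #|f @: A|.
Proof.
move=> fib; rewrite -sum1_card (partition_big_imset f) /= mulnC -sum_nat_const.
apply: eq_bigr => _ /imsetP[x Ax ->]; rewrite sum1_card -(fib x Ax).
by apply: eq_card => y; rewrite !inE.
Qed.

(** * Boundary components *)

Section BoundaryComponents.

Variable S : surface.
Implicit Types (x y z : side S) (B : component S).

Lemma turn_inj : injective (@turn S).
Proof. exact: turn_by_inj (@nxt_cycle3 S) _ (@glue_involutive S). Qed.

Lemma turn_bdry x : on_bdry x -> turn x = nxt x.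
Proof. by rewrite /turn => /eqP->. Qed.

Lemma start_eq x y : y \in start x -> start y = start x.
Proof.
rewrite inE => xy; apply/setP=> z; rewrite !inE; apply/esym/same_connect => //.
by apply: sym_connect_sym => t u /=; rewrite orbC.
Qed.

Lemma start_refl x : x \in start x.
Proof. by rewrite inE connect0. Qed.

(** [about] is a partial function, undefined exactly on the boundary segments; so every side linked
    to [x] leads to [x] by clockwise turns. *)
Lemma mem_start_bdry x y : on_bdry x -> (y \in start x) = connect (@about S) y x.
Proof.
move=> bdry_x; rewrite inE.
have closed_x : closed [rel u v | @about S u v || @about S v u] [pred u | connect (@about S) u x].
  suff about_x u v : about u v -> connect (@about S) u x = connect (@about S) v x.
    by move=> u v /= /orP[/about_x|/about_x/esym].
  move=> uv; apply/idP/idP => [/connectP[[|w p] /=]|]; last exact/connect_trans/connect1.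
    by move=> _ xu; case/andP: uv; rewrite /on_arc -xu bdry_x.
  case/andP=> /andP[_ /eqP->] up ->; case/andP: uv => _ /eqP->.
  by apply/connectP; exists p.
apply/idP/idP => [xy|].
  by have := closed_connect closed_x xy; rewrite !inE connect0 => <-.
have sym_about : connect_sym [rel u v | @about S u v || @about S v u].
  by apply: sym_connect_sym => u v /=; rewrite orbC.
rewrite sym_about; apply: connect_sub => u v uv; apply: connect1.
by rewrite /= [about u v]uv.
Qed.

Lemma start_bdry_inj : {in @on_bdry S &, injective (@start S)}.
Proof.
move=> x y bx by_ xy; have : x \in start y by rewrite -xy start_refl.
rewrite mem_start_bdry // => /connectP[[|z p] //= /andP[/andP[]]].
by rewrite /on_arc [on_bdry x]bx.
Qed.

Lemma connect_about_turn x y : connect (@about S) x y -> fconnect (@turn S) x y.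
Proof.
by apply: connect_sub => u v /andP[_ /eqP->]; apply: fconnect1.
Qed.

Lemma start_orbit x y : y \in start x -> fconnect (@turn S) x y.
Proof.
have [z xz bz] := all_marked x; move=> xy.
have conn u : u \in start x -> fconnect (@turn S) u z.
  rewrite -(start_eq xz) mem_start_bdry //; exact: connect_about_turn.
apply: connect_trans (conn _ (start_refl x)) _.
by rewrite fconnect_sym ?conn //; apply: turn_inj.
Qed.

Lemma connect_bdry_succ x y : on_bdry x -> on_bdry y ->
  connect (@bdry_succ S) x y = fconnect (@turn S) x y.
Proof.
move=> bx by_; apply/idP/idP.
  apply: connect_sub => u v /and3P[bu bv /eqP uv].
  apply: connect_trans (fconnect1 _ u) _; rewrite turn_bdry //.
  by apply: start_orbit; rewrite -/(end_ u) uv start_refl.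
move/connectP=> [p fp def_y]; have: exists k, y = iter k (@turn S) x.
  case/fpathP: fp def_y => k -> ->; exists k; by rewrite last_traject.
case=> -[->|k def_y']; first exact: connect0.
(* [w] is the last boundary segment met strictly before the current term; since then the orbit has
   only turned about the end of [w]. *)
have [w [bw xw wy]] : exists w, [/\ on_bdry w, connect (@bdry_succ S) x w
    & connect (@about S) (nxt w) (iter k.+1 (@turn S) x)].
  elim: {def_y'} k => [|k [w [bw xw wz]]].
    by exists x; split=> //=; rewrite ?turn_bdry.
  set z := iter _ _ _ in wz; rewrite iterS -/z.
  have [bz|az] := boolP (on_bdry z); last first.
    exists w; split=> //; apply: connect_trans wz (connect1 _).
    by apply/andP; split.
  exists z; split; rewrite ?turn_bdry //; apply: connect_trans xw (connect1 _).
  by apply/and3P; split=> //; apply/eqP/start_eq; rewrite mem_start_bdry.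
rewrite -def_y' in wy; apply: connect_trans xw (connect1 _).
by apply/and3P; split=> //; apply/eqP/start_eq; rewrite mem_start_bdry.
Qed.

Lemma connect_bdry_succ_bdry x y :
  on_bdry x -> connect (@bdry_succ S) x y -> on_bdry y.
Proof.
move=> bx /connectP[p]; elim/last_ind: p => [|p z _]; first by move=> _ ->.
by rewrite rcons_path last_rcons => /andP[_ /and3P[_ bz _]] ->.
Qed.

Lemma mem_component B x y :
  x \in val B -> (y \in val B) = on_bdry y && fconnect (@turn S) x y.
Proof.
case: B => B /= /imsetP[z bz ->]; rewrite !inE in bz *.
move=> zx; have bx := connect_bdry_succ_bdry bz zx.
have sym_turn := fconnect_sym turn_inj.
rewrite connect_bdry_succ // in zx.
apply/idP/andP => [zy|[by_ xy]].
  have by_ := connect_bdry_succ_bdry bz zy; split=> //; rewrite connect_bdry_succ // in zy.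
  by apply: connect_trans zy; rewrite sym_turn.
by rewrite connect_bdry_succ //; apply: connect_trans xy.
Qed.

Lemma component_bdry B x : x \in val B -> on_bdry x.
Proof. by move=> Bx; have := Bx; rewrite (mem_component _ Bx) => /andP[]. Qed.

Lemma card_triangles : #|side S| = 3 * #|triangles S|.
Proof.
have n3 := @nxt_cycle3 S; have n_neq := @nxt_neq S.
apply: card_imset_fibers => x _.
have -> : [set y in predT | triangle y == triangle x] = triangle x.
  apply/setP=> y; rewrite [LHS]inE /=; apply/eqP/idP => [<-|]; first by rewrite !inE eqxx.
  rewrite !inE => /orP[/orP[]|] /eqP->; apply/setP=> z; rewrite !inE ?n3;
    by case: (z == x); case: (z == nxt x); case: (z == nxt (nxt x)).
rewrite /triangle setUC cardsU1 cards2 !inE (inj_eq (n_inj n3)).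
by rewrite (negPf (nn_neq n3 n_neq x)) (negPf (n_neq x)) (eq_sym x) n_neq.
Qed.

Lemma card_arc_sides : #|[set x : side S | on_arc x]| = 2 * #|arcs S|.
Proof.
have gK := @glue_involutive S.
rewrite cardsE; apply: card_imset_fibers => x.
  rewrite unfold_in => arc_x; rewrite (_ : [set _ in _ | _] = arc_of x).
    by rewrite cards2 eq_sym (arc_x : glue x != x).
  apply/setP=> y; rewrite !inE; apply/andP/orP => [[_ /eqP xy]|].
    by apply/orP; move: (set21 y (glue y)); rewrite -/(arc_of y) xy !inE.
  case=> /eqP->; split=> //; first by rewrite unfold_in /on_bdry gK eq_sym.
  by rewrite /arc_of gK setUC.
Qed.

Lemma card_marked_points : #|marked_points S| = #|bdry_segments S|.
Proof.
rewrite -(card_in_imset (f := @start S) (D := bdry_segments S)).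
  apply: eq_card => v; apply/imsetP/imsetP => [[x _ ->]|[x _ ->]]; last by exists x.
  by have [y xy by_] := all_marked x; exists y; rewrite ?inE ?(start_eq xy).
by move=> x y; rewrite !inE; apply: start_bdry_inj.
Qed.

(** By connectedness [K] contains all sides. They form one orbit, hence there is one boundary
    component; and there are as many marked points as boundary segments, so the Euler characteristic
    is triangles minus arcs, which is 1. *)
Lemma collapsed_disc x : collapsed (@nxt S) (@glue S) x -> is_disc S.
Proof.
case=> K [Kx closedK subK cardK].
have KT y : y \in K.
  have closedK' : closed [rel y z | (z == nxt y) || (z == glue y)] (mem K).
    have gK := @glue_involutive S; have n3 := @nxt_cycle3 S.
    have Kn u : u \in K -> nxt u \in K by move=> /closedK/andP[].
    have Kg u : u \in K -> glue u \in K by move=> /closedK/andP[].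
    move=> u v /= /orP[] /eqP->; apply/idP/idP; [exact: Kn|move=> /Kn/Kn|exact: Kg|move=> /Kg].
      by rewrite n3.
    by rewrite gK.
  by rewrite -(closed_connect closedK' (glue_connected x y)).
apply/andP; split.
  have [z _ bz] := all_marked x.
  rewrite (_ : bdry_components S = [set bdry_segments S]) ?cards1 //.
  have all_bdry u : on_bdry u -> [set v | connect (@bdry_succ S) u v] = bdry_segments S.
    move=> bu; apply/setP=> v; rewrite !inE; apply/idP/idP => [|bv].
      exact: connect_bdry_succ_bdry.
    rewrite connect_bdry_succ //; apply: (connect_trans (y := x)).
      by rewrite fconnect_sym ?fconnect_orbit ?subK //; apply: turn_inj.
    by rewrite fconnect_orbit subK.
  apply/setP=> B; rewrite !inE; apply/imsetP/eqP => [[u] | ->].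
    by rewrite inE => /all_bdry -> ->.
  by exists z; rewrite ?inE ?all_bdry.
have cardT : #|K| = #|side S| by apply: eq_card => y; rewrite KT.
have card_arcs := card_arc_sides; have card_tri := card_triangles.
rewrite /euler_characteristic card_marked_points.
have -> : #|triangles S| = #|arcs S| + 1.
  move: cardK; rewrite (_ : [set y in K | _] = [set y : side S | on_arc y]); first by lia.
  by apply/setP=> y; rewrite !inE KT.
by apply/eqP; lia.
Qed.

Lemma mem_component_turn B x : x \in val B -> on_bdry (turn x) -> turn x \in val B.
Proof. by move=> Bx btx; rewrite (mem_component _ Bx) btx fconnect1. Qed.

Lemma incident_start x w : on_bdry x -> turn w = x ->
  incident_to_arc (start x) = on_arc w.
Proof.
move=> bx wx; apply/exists_inP/idP => [[y xy arc_y]|arc_w].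
  rewrite mem_start_bdry // in xy; case/connectP: xy => p.
  elim/last_ind: p => [_ /= xy|p z _]; first by rewrite /on_arc -xy bx in arc_y.
  rewrite rcons_path last_rcons => /andP[_ /andP[arc_l /eqP def_z]] xz.
  by rewrite -(turn_inj (etrans (esym def_z) (etrans (esym xz) (esym wx)))).
exists w => //; rewrite mem_start_bdry //; apply: connect1.
by apply/andP; split=> //; rewrite wx.
Qed.

Lemma incident_end x : on_bdry x -> incident_to_arc (end_ x) = on_arc (nxt x).
Proof.
move=> bx; have [bnx|anx] := boolP (on_bdry (nxt x)).
  by rewrite (incident_start bnx (turn_bdry bx)) /on_arc bx bnx.
by rewrite [on_arc _]anx; apply/exists_inP; exists (nxt x); rewrite ?start_refl.
Qed.

(** When [S] is not a disc, each ear is represented once, by the first of its two boundary sides;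
    its tip is the end of that side. *)
Definition ear_segments B : {set side S} := [set x in val B | on_bdry (nxt x)].

Lemma card_points_on B : #|points_on B| = #|val B|.
Proof.
by apply: card_in_imset => x y /component_bdry bx /component_bdry by_;
   apply: start_bdry_inj.
Qed.

Lemma mem_points_on B x z :
  x \in val B -> (start z \in points_on B) = fconnect (@turn S) x z.
Proof.
move=> Bx; apply/imsetP/idP => [[y] | xz].
  rewrite (mem_component _ Bx) => /andP[_ xy] zy; apply: connect_trans xy _.
  by apply: start_orbit; rewrite -zy start_refl.
have [y zy by_] := all_marked z; exists y; last by rewrite (start_eq zy).
by rewrite (mem_component _ Bx) by_ (connect_trans xz) ?start_orbit.
Qed.

Lemma unincident_starts B :
  [set x in val B | ~~ incident_to_arc (start x)] = [set nxt x | x in ear_segments B].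
Proof.
apply/setP=> x; rewrite inE; apply/andP/imsetP => [[Bx]|[w]].
  have [f turnK fK] := injF_bij turn_inj.
  rewrite (incident_start (component_bdry Bx) (fK x)) /on_arc negbK => bw.
  exists (f x); last by rewrite -turn_bdry.
  have Bw : f x \in val B.
    rewrite (mem_component _ Bx) bw fconnect_sym; last exact: turn_inj.
    by rewrite -{2}(fK x) fconnect1.
  by rewrite inE Bw -turn_bdry // fK (component_bdry Bx).
rewrite inE => /andP[Bw bnw] ->; have bw := component_bdry Bw.
rewrite (incident_start bnw (turn_bdry bw)) /on_arc bw.
by rewrite -turn_bdry // mem_component_turn ?turn_bdry.
Qed.

Lemma card_unincident_starts B :
  #|[set x in val B | ~~ incident_to_arc (start x)]| = #|ear_segments B|.
Proof. by rewrite unincident_starts card_imset //; apply/n_inj/nxt_cycle3. Qed.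

Lemma card_incident_points B : incident_points B + #|ear_segments B| = #|points_on B|.
Proof.
rewrite card_points_on -card_unincident_starts /incident_points.
rewrite (_ : [set v in _ | _] = @start S @: [set x in val B | incident_to_arc (start x)]).
  rewrite card_in_imset => [|x y]; last first.
    rewrite !inE => /andP[/component_bdry bx _] /andP[/component_bdry by_ _].
    exact: start_bdry_inj.
  rewrite -(cardsID [set x | incident_to_arc (start x)] (val B)).
  by congr (_ + _); apply: eq_card => x; rewrite !inE // andbC.
apply/setP=> v; rewrite inE; apply/andP/imsetP => [[/imsetP[x Bx ->] inc]|[x]].
  by exists x; rewrite ?inE ?Bx.
by rewrite inE => /andP[Bx inc] ->; split=> //; apply/imsetP; exists x.
Qed.

Hypothesis not_disc : ~~ is_disc S.

Lemma not_three_bdry x : on_bdry x -> on_bdry (nxt x) -> on_arc (nxt (nxt x)).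
Proof.
move=> /eqP b0 /eqP b1; apply: contra not_disc => /eqP b2.
apply: (collapsed_disc (x := x)); apply: collapsed_triangle => //.
  exact: nxt_cycle3.
exact: nxt_neq.
Qed.

Lemma card_incident_segments B :
  incident_segments B + 2 * #|ear_segments B| = #|points_on B|.
Proof.
rewrite card_points_on mul2n -addnn -{1}card_unincident_starts.
set A1 := [set x in _ | ~~ _]; set A2 := ear_segments B.
(* [A1] holds the second and [A2] the first boundary sides of the ears; a common element would give
   a triangle with three boundary sides. *)
have A12 : A1 :&: A2 = set0.
  apply/setP=> x; rewrite in_setI in_set0 /A1 unincident_starts; apply/negP.
  case/andP=> /imsetP[w]; rewrite !inE => /andP[Bw bnw] -> /andP[_ bnnw].
  by have := not_three_bdry (component_bdry Bw) bnw; rewrite /on_arc bnnw.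
have cardU : #|A1 :|: A2| = #|A1| + #|A2| by rewrite cardsU A12 cards0 subn0.
rewrite -cardU -(cardsID (A1 :|: A2) (val B)) addnC; congr (_ + _).
  apply: eq_card => x; rewrite !inE.
  by case: (x \in val B); rewrite ?andbF.
apply: eq_card => x; rewrite !inE; have [Bx|//] := boolP (x \in val B); rewrite ?andbF //=.
by rewrite incident_end ?(component_bdry Bx) // negb_or negbK andbT.
Qed.

End BoundaryComponents.

(** * The degree of the collar curve *)

Section CutWeight.

Variables (S : surface) (d : arrow S -> int).
Implicit Types (x y z : side S).
Local Open Scope ring_scope.

Definition cut_weight x : int := oapp d 0 (insub x).

Lemma cut_weight_arrow (a : arrow S) : cut_weight (val a) = d a.
Proof. by rewrite /cut_weight valK. Qed.

Lemma linear_extension_weight c :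
  linear_extension d (curve_class c) =
    weight (fun x z => turn_weight (@nxt S) cut_weight (glue x) z) c.
Proof.
have sum_arrow x b : \sum_(a : arrow S) ((x == val a) && b)%:R * d a =
    if b then cut_weight x else 0.
  case: b; last by apply: big1 => a _; rewrite andbF mul0r.
  under eq_bigr do rewrite andbT.
  rewrite /cut_weight; case: insubP => [a _ <-|not_arrow] /=; last first.
    apply: big1 => a _; case: eqP => [xa|_]; last by rewrite mul0r.
    by rewrite xa (valP a) in not_arrow.
  rewrite (bigD1 a) //= eqxx mul1r big1 ?addr0 // => a' aa'.
  by rewrite (inj_eq val_inj) eq_sym (negPf aa') mul0r.
rewrite /linear_extension /weight -/(segments c).
transitivity (\sum_(a : arrow S) ((pos_segments a c)%:Z - (neg_segments a c)%:Z) * d a).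
  by apply: eq_bigr => a _; rewrite ffunE.
rewrite /pos_segments /neg_segments.
elim: (segments c) => [|[x z] s IH]; first by rewrite big_nil big1 // => a _; rewrite mul0r.
rewrite big_cons -IH /turn_weight /=.
have -> : (if z == nxt (glue x) then cut_weight (glue x) else 0) =
    \sum_(a : arrow S) ((glue x == val a) && (z == nxt (val a)))%:R * d a.
  rewrite -sum_arrow; apply: eq_bigr => a _.
  by case: eqP => //= <-.
have -> : (if glue x == nxt z then cut_weight z else 0) =
    \sum_(a : arrow S) ((glue x == nxt (val a)) && (z == val a))%:R * d a.
  rewrite -sum_arrow; apply: eq_bigr => a _.
  by rewrite [in RHS]andbC; case: (z =P val a) => //= ->.
rewrite -sumrB -big_split; apply: eq_bigr => a _ /=.
by rewrite !PoszD; case: (_ && _); case: (_ && _) => /=; ring.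
Qed.

Hypothesis cut : admissible_cut d.

Lemma cut_weight01 x : cut_weight x = (cut_weight x == 1)%:R.
Proof.
rewrite /cut_weight; case: insubP => //= a _ _.
by case: cut => /(_ a) []-> _ _.
Qed.

Lemma cut_weight_internal x :
  cut_weight x = 1 -> [/\ on_arc x, on_arc (nxt x) & on_arc (nxt (nxt x))].
Proof.
rewrite /cut_weight; case: insubP => //= a /andP[ax anx] def_a da.
have [_ _ /(_ a da)] := cut; case=> b [c /andP[/eqP/= def_b _]].
by rewrite -def_a -def_b /= in ax anx *; split=> //; case/andP: (valP b).
Qed.

Lemma cut_weight3 x : on_arc x -> on_arc (nxt x) -> on_arc (nxt (nxt x)) ->
  cut_weight x + cut_weight (nxt x) + cut_weight (nxt (nxt x)) = 1.
Proof.
move=> a0 a1 a2.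
have p0 : on_arc x && on_arc (nxt x) by rewrite a0.
have p1 : on_arc (nxt x) && on_arc (nxt (nxt x)) by rewrite a1.
have p2 : on_arc (nxt (nxt x)) && on_arc (nxt (nxt (nxt x))) by rewrite nxt_cycle3 a2.
have [_ /(_ (Sub x p0) (Sub (nxt x) p1) (Sub (nxt (nxt x)) p2)) cut3 _] := cut.
rewrite -!cut_weight_arrow !SubK in cut3; apply: cut3.
by rewrite /three_cycle /follows_in_triangle /= !eqxx.
Qed.

(** A cut has degree 0 on any angle outside the internal triangles, so a segment passing a boundary
    side contributes only the -1 of a backtrack, in an ear. *)
Lemma crossing_weight_collar y : on_arc y ->
  crossing_weight (@nxt S) (@glue S) cut_weight y (next_crossing (@nxt S) (@glue S) y) =
    cut_weight (glue y) - (on_bdry (turn y) && on_bdry (nxt (turn y)))%:R.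
Proof.
have n3 := @nxt_cycle3 S; have n_neq := @nxt_neq S; move=> ay.
have D0 x : ~~ [&& on_arc x, on_arc (nxt x) & on_arc (nxt (nxt x))] -> cut_weight x = 0.
  by rewrite cut_weight01; case: eqP => // /cut_weight_internal[-> -> ->].
rewrite next_crossingE // /crossing_weight -/(turn y).
have [bt|at_] /= := eqVneq (glue (turn y)) (turn y); last first.
  by rewrite turn_weight_next // (negPf (n_neq _)) /on_bdry (negPf at_).
have bt' : on_bdry (turn y) by rewrite /on_bdry bt.
rewrite [cut_weight (glue y)]D0 ?[on_bdry (turn y)]bt' /=; last first.
  by rewrite -/(turn y) /on_arc bt' andbF.
have [bnt|ant] /= := eqVneq (glue (nxt (turn y))) (nxt (turn y)).
  by rewrite turn_weight_refl // eqxx /on_bdry bnt eqxx.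
rewrite -{1}[glue y]n3 turn_weight_prev // (negPf (nn_neq n3 n_neq _)).
rewrite /on_bdry (negPf ant) D0 //.
by rewrite n3 -/(turn y) /on_arc bt' !andbF.
Qed.

Lemma sum_indicator (T : finType) (A : {pred T}) (P : pred T) :
  \sum_(x in A) (P x)%:R = #|[set x in A | P x]|%:R :> int.
Proof.
rewrite -natr_sum -sum1_card; congr (_%:R); rewrite -big_mkcondr.
by apply: eq_bigl => x; rewrite inE.
Qed.

Hypothesis not_disc : ~~ is_disc S.

(** A crossing [y] of degree 1 corresponds to the local cut [glue y], and one followed by a
    backtrack to the ear segment [turn y]. *)
Lemma weight_collar (B : component S) x : x \in val B ->
  weight (crossing_weight (@nxt S) (@glue S) cut_weight) (collar (@nxt S) (@glue S) x) =
    (local_cuts d B)%:Z - #|ear_segments B|%:Z.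
Proof.
have n3 := @nxt_cycle3 S; have n_neq := @nxt_neq S; have gK := @glue_involutive S.
move=> Bx; set q := collar _ _ x.
have mem_q y : (y \in q) = on_arc y && fconnect (@turn S) x y.
  by rewrite mem_filter -fconnect_orbit.
rewrite (weight_fcycle _ (fcycle_collar n3 gK x)).
have uq : uniq q by rewrite filter_uniq // orbit_uniq.
rewrite big_uniq //=.
transitivity (\sum_(y in q) ((cut_weight (glue y) == 1)%:R
               - (on_bdry (turn y) && on_bdry (nxt (turn y)))%:R) : int).
  apply: eq_bigr => y; rewrite mem_q => /andP[ay _].
  by rewrite crossing_weight_collar // -cut_weight01.
rewrite sumrB !sum_indicator !natz; congr (_%:Z - _%:Z).
  rewrite /local_cuts -(card_imset _ (f := fun a : arrow S => glue (val a))); last first.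
    by move=> a b /(can_inj gK)/val_inj.
  apply: eq_card => y; apply/idP/imsetP.
    rewrite inE mem_q => /andP[/andP[ay xy] /eqP Dy].
    have [agy aty _] := cut_weight_internal Dy.
    have p : on_arc (glue y) && on_arc (nxt (glue y)) by rewrite agy.
    exists (Sub (glue y) p); last by rewrite SubK gK.
    rewrite inE -cut_weight_arrow SubK Dy eqxx /= /end_ (mem_points_on _ Bx).
    by rewrite -/(turn y) -(same_fconnect1_r (@turn_inj S)).
  case=> a; rewrite inE => /andP[/eqP da]; rewrite /end_ (mem_points_on _ Bx) => xa ->.
  rewrite inE mem_q gK cut_weight_arrow da eqxx andbT (same_fconnect1_r (@turn_inj S)).
  have /andP[aa _] := valP a; rewrite /turn gK xa andbT.
  by rewrite /on_arc /on_bdry gK eq_sym.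
rewrite -(card_imset _ (@turn_inj S)); apply: eq_card => b; apply/imsetP/idP.
  case=> y; rewrite inE mem_q => /andP[/andP[_ xy] /andP[bt bnt]] ->.
  by rewrite inE bnt andbT (mem_component _ Bx) bt -(same_fconnect1_r (@turn_inj S)).
rewrite inE (mem_component _ Bx) => /andP[/andP[bb xb] bnb].
have [f _ fK] := injF_bij (@turn_inj S); exists (f b); last by rewrite fK.
rewrite inE mem_q (same_fconnect1_r (@turn_inj S)) fK xb bb bnb !andbT.
(* The predecessor of an ear segment lies on an arc, or else the ear would have three boundary
   sides. *)
apply/negP => bfb; have nfb : nxt (f b) = b by rewrite -turn_bdry ?fK.
by have := not_three_bdry not_disc bfb; rewrite nfb /on_arc bnb => /(_ bb).
Qed.

End CutWeight.

Theorem proposition5p3 (S : surface) (d : arrow S -> int)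
    (nm : component S -> nat * nat) (c : component S -> seq (side S)) :
  ~~ is_disc S ->
  admissible_cut d ->
  AG_correspondence d nm ->
  (forall B, surrounds B (c B)) ->
  forall B,
    ((nm B).1%:Z = #|points_on B|%:Z
                   + linear_extension d (curve_class (c B)))%R /\
    ((nm B).2%:Z = #|points_on B|%:Z
                   + 2 * linear_extension d (curve_class (c B)))%R.
Proof.
move=> not_disc cut [_ nmE] around B; rewrite nmE /= linear_extension_weight.
have n3 := @nxt_cycle3 S; have n_neq := @nxt_neq S; have gK := @glue_involutive S.
have [_ red_c [x Bx hom_c]] := around B.
pose F := crossing_weight (@nxt S) (@glue S) (cut_weight d).
have cyc_c : cycle [rel y z | z != glue y] (c B).
  apply: sub_cycle red_c => y z /=; apply: contra => /eqP->.
  by rewrite /arc_of gK setUC.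
have rc := reduced_cycle cyc_c.
have [r xr rr] := normal_form_ex (@glue S) (collar_curve x).
have weight_c : weight F (c B) = ((local_cuts d B)%:Z - #|ear_segments B|%:Z)%R.
  rewrite -(weight_collar cut not_disc Bx).
  rewrite -(homotopic_weight F hom_c xr rr (ReducesRefl _ _) rc).
  apply: (weight_normal_form n3 n_neq _ gK gK _ _ xr rr) => //.
  - by move=> z a0 a1 a2; apply: cut_weight3.
  - by move=> z; right.
  by move=> coll; rewrite (collapsed_disc coll) in not_disc.
(* [c B] has no backtracks, so the correction in [crossing_weight] vanishes on it. *)
have -> : weight (fun y z => turn_weight (@nxt S) (cut_weight d) (glue y) z) (c B) =
    weight F (c B).
  apply: (eq_weight_cycle _ cyc_c) => y z /= yz.
  by rewrite /F /crossing_weight (negPf yz) subr0.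
have := card_incident_points B; have := card_incident_segments not_disc B.
rewrite {}weight_c; move: #|points_on B| #|ear_segments B| (local_cuts d B) => p u l.
move: (incident_segments B) (incident_points B) => m n mE nE.
by split; [rewrite -nE|rewrite -mE]; rewrite !(PoszD, PoszM); ring.
Qed.
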